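(* Let $K$ be a field and let $G=G_1\cup G_2$ be a connected graph such that $V(G_1)\cap V(G_2)=\{v\}$ and $J_G$ is unmixed. If $v$ is a non-free vertex of both $G_1$ and $G_2$, then $J_{G\setminus\{v\}}$ is unmixed.
   Context: All graphs are finite and simple. For a graph $G$ with vertices labelled $V(G)=\{1,\dots,n\}$ and a field $K$, the binomial edge ideal is $J_G=\langle x_iy_j-x_jy_i \mid \{i,j\}\in E(G),\ i<j\rangle\subseteq \mathcal S=K[x_1,\dots,x_n,y_1,\dots,y_n]$ (for a general vertex set, label the vertices; the labelling does not affect the properties of $\mathcal S/J_G$). $J_G$ (a radical ideal) is called unmixed if all its minimal primes have the same height. For $T\subseteq V(G)$, $G\setminus T$ is the induced subgraph on $V(G)\setminus T$. A vertex $v$ is a free vertex of $G$ if the induced subgraph of $G$ on the set of neighbours of $v$ is complete. $G=G_1\cup G_2$ means $V(G)=V(G_1)\cup V(G_2)$ and $E(G)=E(G_1)\cup E(G_2)$. *)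

(* Defs.v *)
From HB Require Import structures.
From mathcomp Require Import all_boot all_order all_algebra.
From mathcomp.multinomials Require Import mpoly.

Set Implicit Arguments.
Unset Strict Implicit.
Unset Printing Implicit Defensive.

Import GRing.Theory.

(* Finite simple graphs.  The vertex set is a subset of an ambient finite     *)
(* type, so that unions and vertex deletions live on the same type.           *)

Record sgraph (T : finType) := SGraph {
  vset : {set T};
  adj : rel T;
  adj_sym : ssrbool.symmetric adj;
  adj_irrefl : irreflexive adj;
  adj_vset : forall x y, adj x y -> (x \in vset) && (y \in vset)
}.

Section Graphs.
Variable T : finType.
Implicit Types (G H : sgraph T) (S : {set T}) (v : T).

Definition is_union G G1 G2 : Prop :=
  vset G = vset G1 :|: vset G2 /\
  forall x y, adj G x y = adj G1 x y || adj G2 x y.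

Definition connected_graph G : Prop :=
  vset G != set0 /\
  {in vset G &, forall x y, connect (adj G) x y}.

Definition free_vertex G v : Prop :=
  forall x y, adj G v x -> adj G v y -> x != y -> adj G x y.

Definition del_adj G S : rel T :=
  fun x y => [&& adj G x y, x \notin S & y \notin S].

Lemma del_adj_sym G S : ssrbool.symmetric (del_adj G S).
Proof. by move=> x y; rewrite /del_adj adj_sym [(x \notin S) && _]andbC. Qed.

Lemma del_adj_irrefl G S : irreflexive (del_adj G S).
Proof. by move=> x; rewrite /del_adj adj_irrefl. Qed.

Lemma del_adj_vset G S x y :
  del_adj G S x y -> (x \in vset G :\: S) && (y \in vset G :\: S).
Proof.
by case/and3P=> /adj_vset/andP[xG yG] xS yS; rewrite !inE xG yG xS yS.
Qed.

Definition del_vertices G S : sgraph T :=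
  SGraph (@del_adj_sym G S) (@del_adj_irrefl G S) (@del_adj_vset G S).

End Graphs.

(* Ideals are Prop-valued predicates: the boolean predicates of ring_quotient *)
(* would only account for ideals with a decidable membership.                 *)

Section Ideals.
Variable R : comNzRingType.
Local Open Scope ring_scope.
Implicit Types (A I J P Q : R -> Prop).

Definition subideal I J : Prop := forall f, I f -> J f.

Definition is_ideal I : Prop :=
  [/\ I 0, forall f g, I f -> I g -> I (f + g) & forall c f, I f -> I (c * f)].

Definition is_prime P : Prop :=
  [/\ is_ideal P, ~ P 1 & forall f g, P (f * g) -> P f \/ P g].

Definition ideal_gen A : R -> Prop := fun f =>
  exists2 s : seq (R * R),
    forall p, p \in s -> A p.2 & f = \sum_(p <- s) p.1 * p.2.

Definition is_minimal_prime J P : Prop :=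
  [/\ is_prime P, subideal J P &
      forall Q, is_prime Q -> subideal J Q -> subideal Q P -> subideal P Q].

(* Q 0, ..., Q k is a strictly increasing chain of primes with Q k = P.       *)
Definition prime_chain P (k : nat) (Q : nat -> R -> Prop) : Prop :=
  [/\ forall i, (i <= k)%N -> is_prime (Q i),
      forall i, (i < k)%N -> subideal (Q i) (Q i.+1) /\ ~ subideal (Q i.+1) (Q i)
    & forall f, Q k f <-> P f].

Definition has_height P (h : nat) : Prop :=
  (exists Q : nat -> R -> Prop, prime_chain P h Q) /\
  (forall k (Q : nat -> R -> Prop), prime_chain P k Q -> (k <= h)%N).

(* A prime of infinite height satisfies [has_height] for no h, so the         *)
(* equivalence below is equality of heights in nat extended with infinity.    *)
Definition unmixed J : Prop :=
  forall P1 P2, is_minimal_prime J P1 -> is_minimal_prime J P2 ->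
  forall h, has_height P1 h <-> has_height P2 h.

End Ideals.

(* The vertices are labelled by 'I_n, n = #|vset G|, through [enum_val]; the  *)
(* n + n variables are x_1, ..., x_n, y_1, ..., y_n in this order.            *)

Section BinomialEdgeIdeal.
Variables (K : fieldType) (T : finType) (G : sgraph T).
Local Open Scope ring_scope.
Local Notation n := #|vset G|.

Definition xvar (i : 'I_n) : {mpoly K[n + n]} := 'X_(lshift n i).
Definition yvar (i : 'I_n) : {mpoly K[n + n]} := 'X_(rshift n i).

Definition edge_binomial (f : {mpoly K[n + n]}) : Prop :=
  exists i j : 'I_n, [/\ (i < j)%N, adj G (enum_val i) (enum_val j)
                       & f = xvar i * yvar j - xvar j * yvar i].

Definition binomial_edge_ideal : {mpoly K[n + n]} -> Prop :=
  ideal_gen edge_binomial.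

End BinomialEdgeIdeal.

(* Main.v *)
From HB Require Import structures.
Require Import Defs.
From mathcomp Require Import all_boot all_order all_algebra.
From mathcomp Require Import boolp zify ring.
From mathcomp.multinomials Require Import mpoly.

Set Implicit Arguments.
Unset Strict Implicit.
Unset Printing Implicit Defensive.

Import GRing.Theory.
Local Open Scope ring_scope.
Local Open Scope quotient_scope.

(** Write c(S) for the number of connected components of G \ S, and n for the
number of vertices of G.

The proof has an algebraic half, which translates unmixedness into a count of
components, and a combinatorial half, which does the count.

Algebra.  For a set S of vertices, P_S is the kernel of the map that kills x_i
and y_i for i in S and sends (x_i, y_i) to t_i (x_r, y_r) otherwise, where r
represents the component of i in G \ S; it is a prime containing J_G.  If Q is
any prime containing J_G, let S be the set of i with x_i, y_i in Q.  Over the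
fraction field of the quotient by Q, the vectors (x_i, y_i) with i outside S are
nonzero and proportional along edges, hence along components, so that the map
to that field factors through the map defining P_S, and P_S is contained in Q
([prime_contains_comp_prime]).  It follows that the minimal primes of J_G are
the P_S for which every vertex of S has neighbours in two different components
of G \ S; such an S is called a cut set here ([cut_set_minimal_prime],
[minimal_prime_cut_set]).

The height of P_S is |S| + n - c(S).  In a polynomial ring in N variables over a
field, chains of primes have length at most N: elements f_j chosen in the j-th
prime but not in the one before are algebraically independent, and counting
monomials shows that there are at most N such elements ([prime_chain_leq]).
So it is enough to put P_S at the right place in one chain of length N
([has_height_full_chain]), and such a chain is given by the kernels of maps
obtained by specializing the variables one after the other
([subst_prime_chain], [block_prime_height]).  Since the empty set is a cut set,
J_G is unmixed if and only if c(S) = |S| + c(empty set) for all cut sets S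
([unmixed_cut_sets]).

Combinatorics.  Let D = G \ v.  It is the disjoint union of H_1 = G_1 \ v and
H_2 = G_2 \ v, and cut sets of the two parts can be combined freely
([cut_set_glue]).  As v is not free in G_i, it has two neighbours in H_i that
are not adjacent; a minimal set A_i separating them in D is a cut set of D
([minimal_separator]).  If U is a cut set of D that leaves those two neighbours
of v in different components, then U with v added is a cut set of G, so that its
number of components is known.  For a cut set S of D, apply this to the four
sets (S in H_1, A_2 in H_2), (empty, A_2), (A_1, S), (A_1, empty), and subtract:
in both parts, the deletion of S adds exactly as many components as S has
elements there.  The sum of the two parts is the criterion for D. *)

(** * Primes as kernels of maps to fields *)

(** The quotient by a prime ideal that is only a Prop-valued predicate:
membership is made boolean by excluded middle, and the inverses that a unit ring
structure demands are picked by choice, so that the field of fractions can be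
formed. *)
Section PrimeQuotient.
Variables (R : comNzRingType) (P : R -> Prop).
Hypothesis primeP : is_prime P.

Definition primeb : {pred R} := fun f => `[< P f >].

Lemma primebE f : (f \in primeb) = `[< P f >]. Proof. by []. Qed.

Lemma primeb_idealr : idealr_closed primeb.
Proof.
have [[P0 PD PM] P1 _] := primeP.
split=> [||a u v /asboolP Pu /asboolP Pv]; first exact/asboolP.
  by apply/asboolP.
by apply/asboolP/PD => //; apply: PM.
Qed.

HB.instance Definition _ := isIdealr.Build R primeb primeb_idealr.

Lemma primeb_prime : prime_idealr_closed primeb.
Proof.
have [_ _ PP] := primeP.
by move=> u v /asboolP/PP[] /asboolP; rewrite -primebE => ->; rewrite ?orbT.
Qed.

HB.instance Definition _ := isPrimeIdealrClosed.Build R primeb primeb_prime.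

Definition domain_quot := {ideal_quot primeb}.
HB.instance Definition _ := GRing.ComNzRing.on domain_quot.

Definition dq_unit : pred domain_quot := fun x => `[< exists y, y * x = 1 >].
Definition dq_inv (x : domain_quot) : domain_quot :=
  if pselect (exists y, y * x = 1) is left xV then sval (cid xV) else x.

Lemma dq_mulVx : {in dq_unit, left_inverse 1 dq_inv *%R}.
Proof.
move=> x /asboolP xU; rewrite /dq_inv; case: pselect => // xV.
by case: cid.
Qed.

Lemma dq_unitPl x y : y * x = 1 -> dq_unit x.
Proof. by move=> yx; apply/asboolP; exists y. Qed.

Lemma dq_inv_out : {in [predC dq_unit], dq_inv =1 id}.
Proof.
by move=> x /asboolP xU; rewrite /dq_inv; case: pselect.
Qed.

HB.instance Definition _ :=
  GRing.ComNzRing_hasMulInverse.Build domain_quot dq_mulVx dq_unitPl dq_inv_out.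
HB.instance Definition _ :=
  GRing.ComUnitRing_isIntegral.Build domain_quot
    (@Quotient.rquot_IdomainAxiom R primeb).

Definition residue_map : {rmorphism R -> {fraction domain_quot}} :=
  (@tofrac domain_quot) \o (\pi_(domain_quot)).

End PrimeQuotient.

Lemma residue_map_eq0 (R : comNzRingType) (P : R -> Prop) (primeP : is_prime P)
  f :
  residue_map primeP f = 0 <-> P f.
Proof.
rewrite /residue_map /=.
rewrite (rwP eqP) tofrac_eq0 -(rmorph0 (\pi_(domain_quot primeP)))
  -Quotient.idealrBE subr0.
by rewrite primebE; split=> [/asboolP|?]; last exact/asboolP.
Qed.

(** * Lengths of chains of primes in a polynomial ring *)

Lemma mpoly_morph_eq (R : comNzRingType) (S : comNzRingType) n
    (a b : {rmorphism {mpoly R[n]} -> S}) :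
  (forall c, a c%:MP = b c%:MP) -> (forall i, a 'X_i = b 'X_i) -> a =1 b.
Proof.
move=> abC abX f; rewrite (mpolyE f) !rmorph_sum; apply: eq_bigr => m _ /=.
rewrite -mul_mpolyC !rmorphM abC mpolyXE_id !rmorph_prod; congr (_ * _).
by apply: eq_bigr => i _; rewrite !rmorphXn /= abX.
Qed.

Section Counting.
Variables (K : fieldType) (M N : nat) (h : 'I_M -> {mpoly K[N]}).
Local Notation ev := (mmap (@mpolyC N K) h).

Lemma msize_eval_monomial D (m : 'X_{1..M}) :
  (forall i, msize (h i) < D)%N -> (msize (ev 'X_[m]) <= D * mdeg m + 1)%N.
Proof.
move=> hD; rewrite mmapX /mmap1 mdegE.
elim/big_rec2: _ => [|i e p _ IH]; first by rewrite msize1 muln0.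
elim: (m i) => [|k IHk]; first by rewrite expr0 mul1r.
rewrite exprS -mulrA (leq_trans (msizeM_le _ _)) //.
by rewrite addSn mulnS -addnA -addSn leq_add.
Qed.

(** Monomials with bounded exponents, counted as functions: there are d ^ n of
them. *)
Definition box d n (a : {ffun 'I_n -> 'I_d}) : 'X_{1..n} :=
  [multinom (a i : nat) | i < n].

Lemma box_inj d n : injective (@box d n).
Proof.
by move=> a b /mnmP ab; apply/ffunP => i; apply/val_inj; have := ab i;
  rewrite !mnmE.
Qed.

(** The d ^ M monomials with exponents below d have linearly independent images,
and these lie in the span of the e ^ N monomials with exponents below e. *)
Lemma alg_indep_count D d e :
    (forall i, msize (h i) < D)%N -> (D * (M * d) < e)%N ->
    (forall g, ev g = 0 -> g = 0) ->
  (d ^ M <= e ^ N)%N.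
Proof.
move=> hD lte inj.
(* The matrix of ev, from the monomials of one box to those of the other. *)
pose A := \matrix_(i < #|{: {ffun 'I_M -> 'I_d}}|, j <
  #|{: {ffun 'I_N -> 'I_e}}|)
  (ev 'X_[box (enum_val i)])@_(box (enum_val j)).
suff: row_free A.
  by move/eqP => rA; have := rank_leq_col A; rewrite rA !card_ffun !card_ord.
rewrite -kermx_eq0; apply/rowV0P => u /sub_kermxP uA.
pose g := \sum_i u 0 i *: 'X_[box (enum_val i)] : {mpoly K[M]}.
have evg : ev g = \sum_i u 0 i *: ev 'X_[box (enum_val i)].
  by rewrite raddf_sum; apply: eq_bigr => i _; rewrite /= mmapZ mul_mpolyC.
have g0 : g = 0.
  apply: inj; apply/mpolyP => b; rewrite mcoeff0 evg raddf_sum /=.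
  have [/existsP[a /eqP ->] | nb] := boolP
    [exists a : {ffun 'I_N -> 'I_e}, b == box a].
    have := congr1 (fun B : 'rV_ _ => B 0 (enum_rank a)) uA;
      rewrite !mxE => uA0.
    rewrite -[RHS]uA0.
    by apply: eq_bigr => i _; rewrite mcoeffZ mxE enum_rankK.
  apply: big1 => i _; rewrite mcoeffZ; apply/eqP; rewrite mulf_eq0 orbC.
  apply/orP; left; rewrite mcoeff_eq0; apply: contra nb => /msize_mdeg_lt bA.
  have be j : (b j < e)%N.
    rewrite (@leq_ltn_trans (mdeg b)) //;
      first by rewrite mdegE (bigD1 j) ?leq_addr.
    rewrite (leq_trans bA) // (leq_trans (msize_eval_monomial _ hD)) //.
    rewrite addn1 (leq_trans _ lte) // ltnS leq_mul2l mdegE; apply/orP; right.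
    rewrite -[X in (_ <= X * _)%N](card_ord M) -sum_nat_const.
    by apply: leq_sum => k _; rewrite mnmE ltnW.
  apply/existsP; exists [ffun j => Ordinal (be j)].
  by apply/eqP/mnmP => j; rewrite mnmE ffunE.
apply/rowP => i; rewrite mxE; have := congr1 (mcoeff (box (enum_val i))) g0.
rewrite mcoeff0 raddf_sum /= (bigD1 i) //= mcoeffZ mcoeffX eqxx mulr1.
rewrite big1 ?addr0 // => j ji; rewrite mcoeffZ mcoeffX.
by rewrite (inj_eq (@box_inj _ _)) (inj_eq enum_val_inj) (negPf ji) mulr0.
Qed.

(** The box count compares d ^ M with (C d) ^ N, where C does not depend on d;
if M > N, this fails for d larger than C ^ N. *)
Lemma alg_indep_leq : (forall g, ev g = 0 -> g = 0) -> (M <= N)%N.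
Proof.
move=> inj; rewrite leqNgt; apply/negP => ltNM.
pose D := (\max_i (msize (h i)).+1)%N.
have hD i : (msize (h i) < D)%N.
  exact: (leq_bigmax (F := fun i => (msize (h i)).+1) i).
pose C := (D * M).+1; pose d := (C ^ N).+1.
have lt_box : (D * (M * d) < C * d)%N.
  by rewrite mulSn mulnA -[X in (X < _)%N]add0n -addSn leq_add.
have := alg_indep_count hD lt_box inj.
apply/negP; rewrite -ltnNge (@leq_trans (d ^ N.+1)) // ?leq_pexp2l //.
by rewrite expnMn expnS ltn_pmul2r // expn_gt0.
Qed.

End Counting.

Lemma muniXwiden (R : comNzRingType) n (i : 'I_n) :
  muni ('X_(widen_ord (leqnSn n) i) : {mpoly R[n.+1]}) = ('X_i)%:P.
Proof.
rewrite muniE msuppX big_seq1 mcoeffX eqxx scale1r mnm1E.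
have -> : (widen_ord (leqnSn n) i == ord_max) = false.
  by rewrite -val_eqE /= ltn_eqF.
rewrite expr0 alg_polyC; congr ('X_[_])%:P; apply/mnmP => j;
  rewrite mnmE !mnm1E.
by [].
Qed.

Lemma muniXmax (R : comNzRingType) n :
  muni ('X_ord_max : {mpoly R[n.+1]}) = 'X.
Proof.
rewrite muniE msuppX big_seq1 mcoeffX eqxx scale1r mnm1E eqxx expr1.
rewrite (_ : [multinom _ | i < n] = 0%MM) ?mpolyX0 ?scale1r //.
apply/mnmP => j; rewrite mnmE mnm0E mnm1E.
by rewrite -val_eqE /= gtn_eqF.
Qed.

(** Evaluation in n.+1 elements, done in two steps: the last variable is kept
apart so that independence can be proved one element at a time. *)
Lemma mmap_muni (K : comNzRingType) (S : comNzRingType)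
  (f : {rmorphism K -> S}) n
    (h : 'I_n.+1 -> S) (p : {mpoly K[n.+1]}) :
  mmap f h p =
  (map_poly (mmap f (fun i => h (widen_ord (leqnSn n) i)))
    (muni p)).[h ord_max].
Proof.
set h' := fun i => _.
pose a : {rmorphism _ -> S} := mmap f h.
pose b : {rmorphism _ -> S} :=
  horner_eval (h ord_max) \o map_poly (mmap f h') \o @muni n K.
change (a p = b p); apply: mpoly_morph_eq => [c|i].
  by rewrite /= muniC map_polyC /= /horner_eval hornerC !mmapC.
rewrite /= mmapX mmap1U /horner_eval.
case: (unliftP ord_max i) => [j ->|->];
  last by rewrite muniXmax map_polyX hornerX.
have -> : lift ord_max j = widen_ord (leqnSn n) j by exact/val_inj/lift_max.
by rewrite muniXwiden map_polyC hornerC /= mmapX mmap1U.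
Qed.

Lemma muni_inj (R : comNzRingType) n : injective (@muni n R).
Proof.
move=> p q pq.
pose X_ (i : 'I_n.+1) : {mpoly R[n.+1]} := 'X_i.
have id_mmap (r : {mpoly R[n.+1]}) : mmap (@mpolyC n.+1 R) X_ r = r.
  apply: (@mpoly_morph_eq _ _ _ (mmap (@mpolyC n.+1 R) X_) idfun) => [c|i] /=.
    by rewrite mmapC.
  by rewrite mmapX mmap1U.
by rewrite -[p]id_mmap -[q]id_mmap !mmap_muni pq.
Qed.

Section ChainBound.
Variables (K : fieldType) (N : nat).
Local Notation S := {mpoly K[N]}.

(** Elements f i that enter the chain at step i.+1 are algebraically independent
modulo its bottom. The chain is descended from the top: in a relation u(f) in Q
j, read as a polynomial in the newly added f j, the constant term lies in Q j.+1
because f j does, so it vanishes by induction, and f j can be divided out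
because Q j is prime. *)
Lemma prime_chain_alg_indep (P : S -> Prop) k (Q : nat -> S -> Prop)
  (f : nat -> S) :
    prime_chain P k Q ->
    (forall i, (i < k)%N -> Q i.+1 (f i) /\ ~ Q i (f i)) ->
  forall m, (m <= k)%N -> forall g : {mpoly K[m]},
    Q (k - m)%N (mmap (@mpolyC N K) (fun i => f (k - i.+1)%N) g) -> g = 0.
Proof.
case=> primeQ chainQ _ fQ; elim=> [_ g|m IH ltmk g].
  rewrite subn0.
  have -> : g = (g@_0)%:MP.
    apply/mpolyP => b; rewrite mcoeffC.
    by rewrite (_ : b = 0%MM) ?eqxx ?mulr1 //; apply/mnmP => -[].
  rewrite mmapC; have [-> _|c0 Qc] := eqVneq (g@_0) 0; first by rewrite mpolyC0.
  have [[_ _ QM] Q1 _] := primeQ k (leqnn k).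
  case: Q1; rewrite -mpolyC1 -(mulVf c0) mpolyCM; exact: QM.
rewrite mmap_muni /= => Qg; apply: muni_inj; rewrite muni0.
have km : (k - m = (k - m.+1).+1)%N by rewrite subnSK.
move: (muni g) Qg => {g} u.
have lt_j : (k - m.+1 < k)%N by rewrite ltn_subrL (leq_ltn_trans _ ltmk).
have := IH (ltnW ltmk); rewrite km.
move: (k - m.+1)%N lt_j => j lt_jk {}IH.
have [Qf nQf] := fQ j lt_jk; have [sQ _] := chainQ j lt_jk.
have [[_ QD QM] _ _] := primeQ _ lt_jk.
have [_ _ Qprime] := primeQ _ (ltnW lt_jk).
elim/poly_ind: u => // u c IHu.
rewrite rmorphD rmorphM /= map_polyX map_polyC /= hornerD hornerMX hornerC.
set w := (map_poly _ _).[_] => Qu.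
(* The value of c is the difference of u(f) and w * f j, both in Q j.+1. *)
have c0 : c = 0.
  apply: IH; rewrite -[mmap _ _ _](addKr (w * f j)) addrC -mulNr.
  by apply: QD; [exact: sQ | exact: QM].
rewrite c0 rmorph0 addr0 in Qu.
by case: (Qprime _ _ Qu) => [/IHu -> //|//]; rewrite mul0r c0 addr0.
Qed.

Lemma prime_chain_leq (P : S -> Prop) k Q : prime_chain P k Q -> (k <= N)%N.
Proof.
move=> chQ; have [primeQ chainQ _] := chQ.
have fP i : exists f, (i < k)%N -> Q i.+1 f /\ ~ Q i f.
  have [ik|_] := boolP (i < k)%N; last by exists 0.
  have [_ nsub] := chainQ i ik; apply: contrapT => nf; apply: nsub => f Qf.
  by apply: contrapT => nQf; apply: nf; exists f.
pose f i := sval (cid (fP i)).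
have fQ i : (i < k)%N -> Q i.+1 (f i) /\ ~ Q i (f i)
  by exact: (svalP (cid (fP i))).
apply: (@alg_indep_leq K k N (fun i => f (k - i.+1)%N)) => g g0.
apply: (prime_chain_alg_indep chQ fQ (leqnn k)); rewrite g0 subnn.
by have [[]] := primeQ 0%N (leq0n k).
Qed.

(** A chain ending in Q h can be continued by the rest of the given chain, whose
length is maximal. *)
Lemma has_height_full_chain (Q : nat -> S -> Prop) (P : S -> Prop) h :
  prime_chain P N Q -> (h <= N)%N -> has_height (Q h) h.
Proof.
case=> primeQ chainQ _ hN; split.
  exists Q; split=> [i ih|i ih|//]; first exact: primeQ (leq_trans ih hN).
  exact: chainQ (leq_trans ih hN).
move=> k Q' [primeQ' chainQ' Q'k].
suff: (k + (N - h) <= N)%N by lia.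
pose Q2 i := if (i < k)%N then Q' i else Q (i - k + h)%N.
apply: (@prime_chain_leq (Q2 (k + (N - h))%N) _ Q2); split=> // i; rewrite /Q2.
  case: ltnP => [ik _|ki]; first exact: primeQ' (ltnW ik).
  by move=> ?; apply: primeQ; lia.
move=> iN; case: (ltngtP i.+1 k) => [ik|ki|ik] /=.
- by apply: chainQ'; apply: ltnW.
- by rewrite subSn // addSn; apply: chainQ; lia.
- have [sQ nsQ] := chainQ' i (eq_leq ik); rewrite ik subnn add0n.
  split=> [g /sQ|sub]; first by rewrite ik Q'k.
  by apply: nsQ => g; rewrite ik Q'k; apply: sub.
Qed.

End ChainBound.

(** * Chains of kernels given by successive substitutions *)

Section SubstitutionChain.
Variables (K : fieldType) (N : nat).
Local Notation S := {mpoly K[N]}.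
Variables (phi0 : {rmorphism S -> S}) (s : 'I_N -> S).

Definition subst_var (z : 'I_N) : {rmorphism S -> S} :=
  mmap (@mpolyC N K) (fun j => if j == z then s z else 'X_j).

Lemma subst_varX z j : subst_var z 'X_j = if j == z then s z else 'X_j.
Proof. by rewrite /= mmapX mmap1U. Qed.

Definition subst_seq (l : seq 'I_N) : {rmorphism S -> S} :=
  foldl (fun (a : {rmorphism S -> S}) z =>
      subst_var z \o a : {rmorphism S -> S}) phi0 l.

Lemma subst_seq_rcons l z f :
  subst_seq (rcons l z) f = subst_var z (subst_seq l f).
Proof. by rewrite /subst_seq foldl_rcons. Qed.

Lemma subst_seq_fixed l f g :
  phi0 f = g -> {in l, forall w, subst_var w g = g} -> subst_seq l f = g.
Proof.
move=> fg; elim/last_ind: l => // l z IH fixg; rewrite subst_seq_rcons IH.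
  by apply: fixg; rewrite mem_rcons mem_head.
by move=> w wl; apply: fixg; rewrite mem_rcons inE wl orbT.
Qed.

Lemma subst_seq_var l f z :
    phi0 f = 'X_z -> z \in l -> {in l, forall w, subst_var w (s z) = s z} ->
  subst_seq l f = s z.
Proof.
move=> fz; elim/last_ind: l => // l w IH zl fixsz; rewrite subst_seq_rcons.
have wl : w \in rcons l w by rewrite mem_rcons mem_head.
have [zl'|zl'] := boolP (z \in l).
  rewrite IH ?fixsz // => w' wl'; apply: fixsz.
  by rewrite mem_rcons inE wl' orbT.
move: zl; rewrite mem_rcons inE (negPf zl') orbF => /eqP zw.
rewrite (subst_seq_fixed fz); first by rewrite subst_varX -zw eqxx.
move=> w' wl'; rewrite subst_varX; case: eqP => // zw'.
by rewrite zw' wl' in zl'.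
Qed.

Lemma kernel_is_prime (A : comNzRingType) (B : idomainType)
  (a : {rmorphism A -> B}) :
  is_prime (fun f => a f = 0).
Proof.
split; first split=> [|f g /= f0 g0|c f /= f0].
- exact: rmorph0.
- by rewrite rmorphD f0 g0 addr0.
- by rewrite rmorphM f0 mulr0.
- by rewrite rmorph1; apply/eqP/oner_neq0.
- by move=> f g /eqP; rewrite rmorphM mulf_eq0 => /orP[] /eqP; [left | right].
Qed.

(** Each specialization enlarges the kernel, and f z witnesses that the one of z
does so strictly: by the last hypothesis, the earlier specializations leave phi0
(f z) as it is. *)
Lemma subst_prime_chain (l : seq 'I_N) (f : 'I_N -> S) :
    (forall z, phi0 (f z) != 0) ->
    (forall z, subst_var z (phi0 (f z)) = 0) ->
    pairwise (fun w z => subst_var w (phi0 (f z)) == phi0 (f z)) l ->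
  prime_chain (fun g => subst_seq l g = 0) (size l)
    (fun m g => subst_seq (take m l) g = 0).
Proof.
move=> f_n0 f_killed f_fixed; split=> [i _|i il|g]; last by rewrite take_size.
  exact: kernel_is_prime.
case: l il f_fixed => // z0 l il f_fixed; set L := z0 :: l in il f_fixed *.
rewrite (take_nth z0 il); split=> [g g0|];
  first by rewrite subst_seq_rcons g0 rmorph0.
move=> /(_ (f (nth z0 L i))); rewrite subst_seq_rcons (subst_seq_fixed erefl);
  last first.
  move=> w /(nthP z0)[j]; rewrite size_take il => ji <-.
  rewrite nth_take //; apply/eqP; move/(pairwiseP z0): f_fixed; apply => //.
  by rewrite inE (ltn_trans ji).
by rewrite f_killed => /(_ erefl)/eqP; apply/negP.
Qed.

End SubstitutionChain.

Definition split_case (A : Type) m n (a : 'I_m -> A) (b : 'I_n -> A)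
  (z : 'I_(m + n)) :=
  match split z with inl i => a i | inr i => b i end.

Lemma split_caseL A m n (a : 'I_m -> A) (b : 'I_n -> A) i :
  split_case a b (lshift n i) = a i.
Proof. by rewrite /split_case -[lshift n i]/(unsplit (inl i)) unsplitK. Qed.

Lemma split_caseR A m n (a : 'I_m -> A) (b : 'I_n -> A) i :
  split_case a b (rshift m i) = b i.
Proof. by rewrite /split_case -[rshift m i]/(unsplit (inr i)) unsplitK. Qed.

(** * The primes given by a partition of the vertices *)

Section BlockPrime.
Variables (K : fieldType) (n : nat) (dead : {set 'I_n}) (r : 'I_n -> 'I_n).
Local Notation S := {mpoly K[n + n]}.
Local Notation x i := ('X_(lshift n i) : S).
Local Notation y i := ('X_(rshift n i) : S).

(** The factor t_i by which (x i, y i) is a multiple of (x (r i), y (r i)). For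
i <> r i it can be any fresh variable, and x i is free for this use because,
apart from these factors, block_map only needs the variables of
representatives. *)
Definition scale_factor i : S := if r i == i then 1 else x i.

(** The generic point of the variety where the vectors (x i, y i) vanish for i
in dead and are proportional along the fibres of r. *)
Definition block_map : {rmorphism S -> S} :=
  mmap (@mpolyC (n + n) K)
    (split_case (fun i => if i \in dead then 0 else x (r i) * scale_factor i)
                (fun i => if i \in dead then 0 else y (r i) * scale_factor i)).

Definition block_prime (f : S) : Prop := block_map f = 0.

Lemma block_mapC c : block_map c%:MP = c%:MP.
Proof. by rewrite /= mmapC. Qed.

Lemma block_map_x i :
  block_map (x i) = if i \in dead then 0 else x (r i) * scale_factor i.
Proof. by rewrite /= mmapX mmap1U split_caseL. Qed.

Lemma block_map_y i :
  block_map (y i) = if i \in dead then 0 else y (r i) * scale_factor i.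
Proof. by rewrite /= mmapX mmap1U split_caseR. Qed.

Lemma block_prime_is_prime : is_prime block_prime.
Proof. exact: kernel_is_prime. Qed.

Lemma mpolyX_neq0 m : 'X_[m] != 0 :> S.
Proof. by rewrite -msize_poly_eq0 msizeX. Qed.

Lemma scale_factor_neq0 i : scale_factor i != 0.
Proof.
rewrite /scale_factor; case: (r i =P i) => _; last exact: mpolyX_neq0.
exact: oner_neq0.
Qed.

Lemma block_prime_x i : block_prime (x i) <-> i \in dead.
Proof.
rewrite /block_prime block_map_x; case: ifP => [//|_]; split=> // /eqP.
by rewrite mulf_eq0 (negPf (mpolyX_neq0 _)) (negPf (scale_factor_neq0 _)).
Qed.

Lemma binomial_neq0 i j : i != j -> x i * y j - x j * y i != 0.
Proof.
move=> ij; rewrite subr_eq0 -!mpolyXD;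
  apply/eqP => /(congr1 (mcoeff (U_(lshift n i) + U_(rshift n j))%MM)).
rewrite !mcoeffX eqxx; case: eqP => [/mnmP/(_ (lshift n i))|_ /eqP];
  last by rewrite oner_eq0.
rewrite !mnmDE !mnm1E !(inj_eq (@lshift_inj _ _)) eqxx eq_sym (negPf ij).
by rewrite !eq_rlshift.
Qed.

(** The image of the binomial is the same binomial in r i and r j, up to a
nonzero factor. *)
Lemma block_prime_binomial i j : i \notin dead -> j \notin dead ->
  block_prime (x i * y j - x j * y i) <-> r i = r j.
Proof.
move=> iL jL; rewrite /block_prime rmorphB !rmorphM !block_map_x !block_map_y.
rewrite (negPf iL) (negPf jL).
have -> : x (r i) * scale_factor i * (y (r j) * scale_factor j) -
    x (r j) * scale_factor j * (y (r i) * scale_factor i) =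
    (x (r i) * y (r j) - x (r j) * y (r i)) * (scale_factor i * scale_factor j).
  by ring.
split=> [/eqP|->]; last by rewrite subrr mul0r.
rewrite !mulf_eq0 !(negPf (scale_factor_neq0 _)) !orbF => e0.
by apply/eqP; apply: contraLR e0 => /binomial_neq0.
Qed.

(** The map block_map is reached from partial_map by specializing the variables
of phase 0; specializing the others as well, phase by phase, ends at the
evaluation at the origin. For each variable z, killed z is the element that
enters the kernel when z is specialized. *)
Section Height.
Hypothesis r_idem : forall i, r (r i) = r i.
Hypothesis r_dead : forall i, (r i \in dead) = (i \in dead).

Definition nonrep i := (i \notin dead) && (r i != i).

Definition partial_map : {rmorphism S -> S} :=
  mmap (@mpolyC (n + n) K)
    (split_case (fun i => if i \in dead then x i else x (r i) * scale_factor i)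
                (fun i => y i)).

Definition subst_value : 'I_(n + n) -> S :=
  split_case (fun=> 0) (fun i => if nonrep i then y (r i) * x i else 0).

(** Chosen so that the image of killed z under partial_map involves, apart from
z, only variables of a later phase. *)
Definition phase : 'I_(n + n) -> nat :=
  split_case (fun i => if i \in dead then 0 else if r i == i then 2 else 1)%N
             (fun i => if (i \notin dead) && (r i == i) then 2 else 0)%N.

Definition killed : 'I_(n + n) -> S :=
  split_case (fun i => x i)
             (fun i => if nonrep i then x (r i) * y i - x i * y (r i) else y i).

Local Notation sub := (subst_var subst_value).

Lemma sub_fix w z : w != z -> sub w 'X_z = 'X_z.
Proof. by move=> wz; rewrite subst_varX eq_sym (negPf wz). Qed.

Lemma sub_fix_phase w z : (phase w < phase z)%N -> sub w 'X_z = 'X_z.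
Proof. by move=> wz; apply: sub_fix; apply: contraTneq wz => ->;
  rewrite ltnn. Qed.

Lemma partial_map_x i :
  partial_map (x i) = if i \in dead then x i else x (r i) * scale_factor i.
Proof. by rewrite /= mmapX mmap1U split_caseL. Qed.

Lemma partial_map_y i : partial_map (y i) = y i.
Proof. by rewrite /= mmapX mmap1U split_caseR. Qed.

Lemma phase_rep_x i : i \notin dead -> phase (lshift n (r i)) = 2.
Proof. by move=> iL;
  rewrite /phase split_caseL r_dead r_idem eqxx (negPf iL). Qed.

Lemma phase_rep_y i : i \notin dead -> phase (rshift n (r i)) = 2.
Proof. by move=> iL; rewrite /phase split_caseR r_dead r_idem eqxx iL. Qed.

Lemma partial_map_killed z :
  partial_map (killed z) =
  split_case (fun i => if i \in dead then x i else x (r i) * scale_factor i)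
    (fun i => if nonrep i then x (r i) * (y i - x i * y (r i)) else y i) z.
Proof.
case: (split_ordP z) => i ->; rewrite /killed !(split_caseL, split_caseR).
  exact: partial_map_x.
case: ifP => [/andP[iL ri]|_]; last exact: partial_map_y.
rewrite rmorphB !rmorphM !partial_map_x !partial_map_y r_dead (negPf iL).
rewrite /scale_factor r_idem eqxx (negPf ri) mulr1.
by rewrite mulrBr mulrA.
Qed.

Lemma partial_map_killed_neq0 z : partial_map (killed z) != 0.
Proof.
rewrite partial_map_killed.
case: (split_ordP z) => i ->; rewrite !(split_caseL, split_caseR).
  case: ifP => _; first exact: mpolyX_neq0.
  by rewrite mulf_neq0 ?mpolyX_neq0 ?scale_factor_neq0.
case: ifP => [/andP[iL ri]|_]; last exact: mpolyX_neq0.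
rewrite mulf_neq0 ?mpolyX_neq0 // subr_eq0 -mpolyXD.
apply/eqP => /(congr1 (mcoeff U_(rshift n i))); rewrite !mcoeffX eqxx.
case: eqP => [/mnmP/(_ (lshift n i))|_ /eqP]; last by rewrite oner_eq0.
by rewrite mnmDE !mnm1E eqxx !eq_rlshift.
Qed.

Lemma sub_killed z : sub z (partial_map (killed z)) = 0.
Proof.
rewrite partial_map_killed.
case: (split_ordP z) => i ->; rewrite !(split_caseL, split_caseR).
  have s0 : sub (lshift n i) (x i) = 0.
    by rewrite subst_varX eqxx /subst_value split_caseL.
  case: ifP => // iL; rewrite rmorphM /scale_factor.
  by case: (r i =P i) => [->|_]; rewrite s0 ?mul0r ?mulr0.
have s0 : sub (rshift n i) (y i) = if nonrep i then y (r i) * x i else 0.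
  by rewrite subst_varX eqxx /subst_value split_caseR.
case: ifP s0 => // nri s0; have /andP[_ ri] := nri.
rewrite rmorphM rmorphB rmorphM s0 !sub_fix ?eq_rlshift //.
  by rewrite [x i * _]mulrC subrr mulr0.
by rewrite (inj_eq (@rshift_inj _ _)) eq_sym.
Qed.

Lemma sub_fix_killed w z : w != z -> (phase w <= phase z)%N ->
  sub w (partial_map (killed z)) = partial_map (killed z).
Proof.
move=> wz; have fixz := sub_fix wz; rewrite partial_map_killed.
move: wz fixz; case: (split_ordP z) => i -> wz fixz;
  rewrite !(split_caseL, split_caseR) => pwz.
  case: ifP => // iL; rewrite rmorphM /scale_factor.
  case: (r i =P i) => [->|/eqP ri]; first by rewrite rmorph1 fixz.
  rewrite fixz sub_fix_phase // phase_rep_x ?iL //.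
  by apply: leq_ltn_trans pwz _; rewrite /phase split_caseL iL (negPf ri).
case: ifP => // nri; have /andP[iL ri] := nri.
move: pwz; rewrite {2}/phase split_caseR iL (negPf ri) leqn0 => /eqP pw0.
rewrite rmorphM rmorphB rmorphM fixz !sub_fix_phase ?pw0 ?phase_rep_x
  ?phase_rep_y //.
by rewrite /phase split_caseL (negPf iL) (negPf ri).
Qed.

Definition in_phase k := [seq z <- enum 'I_(n + n) | phase z == k].
Definition subst_order := in_phase 0 ++ in_phase 1 ++ in_phase 2.

Lemma size_subst_order : size subst_order = (n + n)%N.
Proof.
transitivity (size (enum 'I_(n + n))); last exact: size_enum_ord.
rewrite /subst_order /in_phase; move: (enum 'I_(n + n)) => e.
rewrite !size_cat !size_filter; elim: e => //= z l IH.
suff: ((phase z == 0) + (phase z == 1) + (phase z == 2) = 1)%N by lia.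
by rewrite /phase /split_case; case: (split z) => i; do ?case: ifP.
Qed.

Lemma subst_order_pairwise :
  pairwise (fun w z => sub w (partial_map (killed z)) == partial_map (killed z))
    subst_order.
Proof.
have in_phaseP k z : z \in in_phase k -> phase z = k.
  by rewrite mem_filter => /andP[/eqP].
have pw k : pairwise (fun w z => sub w (partial_map (killed z)) == partial_map
  (killed z)) (in_phase k).
  have: uniq (in_phase k) by rewrite filter_uniq ?enum_uniq.
  rewrite uniq_pairwise;
    apply: (sub_in_pairwise _ (allss (in_phase k))) => w z /in_phaseP wk
    /in_phaseP zk wz.
  by apply/eqP/sub_fix_killed; rewrite // wk zk.
rewrite /subst_order !pairwise_cat !pw !andbT; apply/andP; split;
  apply/allrelP => w z.
  move/in_phaseP => w0 zin; apply/eqP/sub_fix_killed; last by rewrite w0.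
  by apply: contraTneq zin => <-; rewrite mem_cat !mem_filter w0.
move=> /in_phaseP w1 /in_phaseP z2; apply/eqP/sub_fix_killed;
  last by rewrite w1 z2.
by apply: contra_eq_neq z2 => <-; rewrite w1.
Qed.

Lemma size_in_phase0 : size (in_phase 0) =
  (2 * #|dead| + #|[set i | nonrep i]|)%N.
Proof.
rewrite -sum1_size big_filter big_enum_cond big_split_ord /=.
rewrite (eq_bigl (fun i => i \in dead)); last first.
  by move=> i; rewrite /= /phase split_caseL; do ?case: ifP.
rewrite sum1_card [X in (_ + X)%N](eq_bigl
  (fun i => i \in dead :|: [set i | nonrep i])).
  rewrite sum1_card cardsU disjoint_setI0 ?cards0 ?subn0 ?mul2n -?addnn ?addnA
    //.
  by apply/pred0P => i; rewrite /= inE /nonrep; case: (i \in dead).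
move=> i; rewrite /= in_setU inE /phase split_caseR /nonrep.
by case: (i \in dead); case: (r i == i).
Qed.

Lemma subst_phase0 f : subst_seq partial_map subst_value (in_phase 0) f =
  block_map f.
Proof.
have ph0 w : w \in in_phase 0 -> phase w = 0%N
  by rewrite mem_filter => /andP[/eqP].
have mem0 w : phase w = 0%N -> w \in in_phase 0.
  by move=> pw; rewrite mem_filter pw eqxx mem_enum.
apply: (mpoly_morph_eq (a := subst_seq _ _ _)) f => [c|z].
  rewrite block_mapC; elim/last_ind: (in_phase 0) => [|l w IH];
    first by rewrite /= mmapC.
  by rewrite subst_seq_rcons IH /= mmapC.
case: (split_ordP z) => i -> {z}.
  rewrite block_map_x; case: ifP => iL.
    rewrite (subst_seq_var (z := lshift n i)).
    - by rewrite /subst_value split_caseL.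
    - by rewrite partial_map_x iL.
    - by apply: mem0; rewrite /phase split_caseL iL.
    - by move=> w _; rewrite /subst_value split_caseL rmorph0.
  have fi := partial_map_x i; rewrite iL in fi.
  apply: (subst_seq_fixed fi) => w /ph0 pw; rewrite rmorphM.
  rewrite sub_fix_phase ?pw ?phase_rep_x ?iL // /scale_factor.
  case: ifP => ri; first by rewrite rmorph1.
  by rewrite sub_fix_phase // pw /phase split_caseL iL ri.
rewrite block_map_y; case: ifP => iL.
  rewrite (subst_seq_var (z := rshift n i)).
  - by rewrite /subst_value split_caseR /nonrep iL.
  - by rewrite partial_map_y.
  - by apply: mem0; rewrite /phase split_caseR iL.
  - by move=> w _; rewrite /subst_value split_caseR /nonrep iL rmorph0.
rewrite /scale_factor; case: (r i =P i) => [rii|/eqP ri].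
  rewrite rii mulr1; apply: (subst_seq_fixed (partial_map_y i)) => w /ph0 pw.
  by rewrite sub_fix_phase // pw /phase split_caseR iL rii eqxx.
have nri : nonrep i by rewrite /nonrep iL ri.
rewrite (subst_seq_var (z := rshift n i)).
- by rewrite /subst_value split_caseR nri.
- by rewrite partial_map_y.
- by apply: mem0; rewrite /phase split_caseR (negPf ri) andbF.
move=> w /ph0 pw; rewrite /subst_value split_caseR nri rmorphM.
rewrite !sub_fix_phase // pw ?phase_rep_y ?iL //.
by rewrite /phase split_caseL iL (negPf ri).
Qed.

(** The chain runs through all n + n variables, and phase 0 consists of x i and
y i for i in dead and of y i for the other i that are not representatives. *)
Lemma block_prime_height :
  has_height block_prime (2 * #|dead| + #|[set i | nonrep i]|)%N.
Proof.
have := subst_prime_chain partial_map_killed_neq0 sub_killed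
  subst_order_pairwise.
rewrite size_subst_order => chQ.
have le0 : (size (in_phase 0) <= n + n)%N.
  by apply: leq_trans (eq_leq size_subst_order); rewrite size_cat leq_addr.
have := has_height_full_chain chQ le0; rewrite take_size_cat // size_in_phase0.
rewrite (_ : (fun g => _) = block_prime) //.
by apply/funext => f; rewrite subst_phase0.
Qed.

End Height.
End BlockPrime.

(** * Cut sets and components *)

Section GraphComponents.
Variables (T : finType) (G : sgraph T).
Implicit Types (S : {set T}).

Definition num_comp S := n_comp (del_adj G S) (vset G :\: S).

Definition cut_set S :=
  [forall i in S, exists u, exists w,
    [&& adj G i u, adj G i w, u \notin S, w \notin S
      & ~~ connect (del_adj G S) u w]].

Lemma cut_setP S :
  reflect (forall i, i \in S -> exists u w,
    [/\ adj G i u, adj G i w, u \notin S, w \notin S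
      & ~~ connect (del_adj G S) u w])
  (cut_set S).
Proof.
apply: (iffP forall_inP) => cutS i iS.
  have /existsP[u /existsP[w /and5P[]]] := cutS i iS; by exists u, w.
have [u [w [iu iw uS wS uw]]] := cutS i iS.
by apply/existsP; exists u; apply/existsP; exists w; rewrite iu iw uS wS.
Qed.

Lemma cut_set_vset S : cut_set S -> S \subset vset G.
Proof.
move=> /cut_setP cutS; apply/subsetP => i /cutS[u [w [iu _ _ _ _]]].
by have /andP[] := adj_vset iu.
Qed.

Lemma connect_del_sym S : connect_sym (del_adj G S).
Proof. exact/sym_connect_sym/del_adj_sym. Qed.

Lemma connect_del_vset S u w :
  connect (del_adj G S) u w -> (u \in vset G) = (w \in vset G).
Proof.
by apply: closed_connect => a b /and3P[/adj_vset/andP[-> ->]].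
Qed.

Lemma connect_del_deleted S u w :
  connect (del_adj G S) u w -> (u \in S) = (w \in S).
Proof.
by apply: closed_connect => a b /and3P[_ /negPf-> /negPf->].
Qed.

End GraphComponents.

(** Proportionality of vectors in a plane is transitive through a nonzero
vector. *)
Lemma proportional_trans (F : idomainType) (a1 b1 a2 b2 a3 b3 : F) :
    a2 != 0 \/ b2 != 0 -> a1 * b2 = a2 * b1 -> a2 * b3 = a3 * b2 ->
  a1 * b3 = a3 * b1.
Proof.
move=> nz2 e12 e23; case: nz2 => nz; apply: (mulfI nz).
  by rewrite mulrCA e23 mulrCA e12 mulrCA.
have -> : b2 * (a1 * b3) = a1 * b2 * b3 by ring.
have -> : b2 * (a3 * b1) = a3 * b2 * b1 by ring.
by rewrite e12 -e23; ring.
Qed.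

(** * The primes containing a binomial edge ideal *)

Section GraphPrimes.
Variables (K : fieldType) (T : finType) (G : sgraph T).
Local Notation n := #|vset G|.
Local Notation R := {mpoly K[n + n]}.
Local Notation x i := ('X_(lshift n i) : R).
Local Notation y i := ('X_(rshift n i) : R).
Local Notation J := (@binomial_edge_ideal K T G).
Implicit Types (S : {set T}).

Lemma binomial_edge_ideal_sub (I : R -> Prop) :
    is_ideal I ->
    (forall i j : 'I_n, adj G (enum_val i) (enum_val j) ->
      I (x i * y j - x j * y i)) ->
  subideal J I.
Proof.
case=> I0 ID IM adjI _ [s sJ ->].
elim: s sJ => [|p s IH] sJ; first by rewrite big_nil.
rewrite big_cons; apply: ID.
  have [i [j [_ ij ->]]] := sJ p (mem_head _ _); exact/IM/adjI.
by apply: IH => q qs; apply: sJ; rewrite inE qs orbT.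
Qed.

Lemma edge_binomial_ideal (i j : 'I_n) :
  adj G (enum_val i) (enum_val j) -> J (x i * y j - x j * y i).
Proof.
move=> ij; case: (ltngtP i j) => [lij|lji|/val_inj eij].
- exists [:: (1, x i * y j - x j * y i)]; last by rewrite big_seq1 mul1r.
  by move=> p; rewrite inE => /eqP ->; exists i, j.
- exists [:: (-1, x j * y i - x i * y j)];
  last by rewrite big_seq1 mulN1r opprB.
  by move=> p; rewrite inE => /eqP ->; exists j, i; rewrite adj_sym.
- by rewrite eij adj_irrefl in ij.
Qed.

(** If the values of pi satisfy the defining relations of the generic point and
do not vanish at representatives, then pi factors through block_map: t_i is sent
to the ratio of the two proportional vectors. *)
Lemma block_prime_factor (F : fieldType) (pi : {rmorphism R -> F})
    (dead : {set 'I_n}) (r : 'I_n -> 'I_n) :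
    (forall i, r (r i) = r i) ->
    (forall i, i \in dead -> pi (x i) = 0 /\ pi (y i) = 0) ->
    (forall i, i \notin dead -> pi (x (r i)) != 0 \/ pi (y (r i)) != 0) ->
    (forall i, i \notin dead ->
      pi (x i) * pi (y (r i)) = pi (x (r i)) * pi (y i)) ->
  forall f, block_prime dead r f -> pi f = 0.
Proof.
move=> r_idem pi_dead pi_rep pi_prop f.
pose tau i := if pi (x (r i)) != 0 then pi (x i) / pi (x (r i))
              else pi (y i) / pi (y (r i)).
have tau_x i : i \notin dead -> pi (x i) = pi (x (r i)) * tau i.
  move=> iL; rewrite /tau; have := pi_rep i iL.
  case: eqP => /= [x0|/eqP x0] yN0; last by rewrite mulrCA divff ?mulr1.
  case: yN0 => // yN0; rewrite x0 mul0r; apply/eqP.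
  have /eqP := pi_prop i iL; rewrite x0 mul0r mulf_eq0 (negPf yN0) orbF.
  by [].
have tau_y i : i \notin dead -> pi (y i) = pi (y (r i)) * tau i.
  move=> iL; rewrite /tau; have := pi_rep i iL.
  case: eqP => /= [x0|/eqP x0] yN0; last first.
    by rewrite mulrA [_ * pi (x i)]mulrC pi_prop // mulrAC divff ?mul1r.
  by case: yN0 => // yN0; rewrite mulrCA divff ?mulr1.
pose psi : {rmorphism R -> F} := mmap (pi \o @mpolyC (n + n) K)
  (split_case (fun i => if r i == i then pi (x i) else tau i)
    (fun i => pi (y i))).
have psi_x i : psi (x i) = if r i == i then pi (x i) else tau i.
  by rewrite /= mmapX mmap1U split_caseL.
have psi_y i : psi (y i) = pi (y i) by rewrite /= mmapX mmap1U split_caseR.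
have psi_scale i : i \notin dead -> psi (scale_factor K r i) * pi (x (r i)) =
    pi (x i) /\
     psi (scale_factor K r i) * pi (y (r i)) = pi (y i).
  move=> iL; rewrite /scale_factor; case: (r i =P i) => [->|/eqP ri].
    by rewrite rmorph1 !mul1r.
  by rewrite psi_x (negPf ri) ![tau i * _]mulrC -tau_x // -tau_y.
have pi_eq : pi =1 psi \o block_map K dead r.
  apply: mpoly_morph_eq => [c|z]; first by rewrite /= block_mapC /= mmapC.
  case: (split_ordP z) => i ->; rewrite [RHS]/=.
    rewrite block_map_x; case: ifPn => [/pi_dead[-> _]|iL];
      first by rewrite rmorph0.
    by rewrite rmorphM psi_x r_idem eqxx mulrC; case: (psi_scale i iL).
  rewrite block_map_y; case: ifPn => [/pi_dead[_ ->]|iL];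
    first by rewrite rmorph0.
  by rewrite rmorphM psi_y mulrC; case: (psi_scale i iL).
by move=> f0; rewrite pi_eq /= f0 rmorph0.
Qed.

Definition deleted S : {set 'I_n} := [set i | enum_val i \in S].

Definition comp_rep S (i : 'I_n) : 'I_n :=
  enum_rank_in (enum_valP i) (fingraph.root (del_adj G S) (enum_val i)).

Lemma enum_val_comp_rep S i :
  enum_val (comp_rep S i) = fingraph.root (del_adj G S) (enum_val i).
Proof.
by rewrite enum_rankK_in // -(connect_del_vset (connect_root _ _)) enum_valP.
Qed.

Lemma comp_rep_idem S i : comp_rep S (comp_rep S i) = comp_rep S i.
Proof.
by apply: enum_val_inj; rewrite !enum_val_comp_rep root_root //;
  apply: connect_del_sym.
Qed.

Lemma comp_rep_deleted S i : (comp_rep S i \in deleted S) = (i \in deleted S).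
Proof.
by rewrite !inE enum_val_comp_rep -(connect_del_deleted (connect_root _ _)).
Qed.

Lemma comp_rep_eq S i j :
  (comp_rep S i == comp_rep S j) =
  connect (del_adj G S) (enum_val i) (enum_val j).
Proof.
by rewrite -(inj_eq enum_val_inj) !enum_val_comp_rep root_connect //;
  apply: connect_del_sym.
Qed.

Definition comp_prime S : R -> Prop := block_prime (deleted S) (comp_rep S).

Lemma block_prime_contains (dead : {set 'I_n}) (r : 'I_n -> 'I_n) :
    (forall i j, i \notin dead -> j \notin dead ->
       adj G (enum_val i) (enum_val j) ->
       r i = r j) ->
  subideal J (block_prime dead r).
Proof.
move=> r_adj; apply: binomial_edge_ideal_sub => [|i j ij].
  by have [] := block_prime_is_prime K dead r.
have [iD|iL] := boolP (i \in dead).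
  by rewrite /block_prime rmorphB !rmorphM !block_map_x !block_map_y iD mul0r
    mulr0 subrr.
have [jD|jL] := boolP (j \in dead).
  by rewrite /block_prime rmorphB !rmorphM !block_map_x !block_map_y jD mul0r
    mulr0 subrr.
by apply/block_prime_binomial => //; apply: r_adj.
Qed.

Lemma comp_prime_contains S : subideal J (comp_prime S).
Proof.
apply: block_prime_contains => i j; rewrite !inE => iS jS ij.
by apply/eqP; rewrite comp_rep_eq; apply: connect1; rewrite /del_adj ij iS jS.
Qed.

(** Vertices outside S have a nonzero vector (x i, y i) modulo Q, so the
proportionality along edges spreads to the components of G \ S. *)
Lemma prime_contains_comp_prime (Q : R -> Prop) :
    is_prime Q -> subideal J Q ->
  exists S, (forall i, enum_val i \in S <-> Q (x i) /\ Q (y i))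
    /\ S \subset vset G /\ subideal (comp_prime S) Q.
Proof.
move=> primeQ subQ; pose D := [set i | `[< Q (x i) /\ Q (y i) >]].
exists (enum_val @: D).
have memD i : (enum_val i \in enum_val @: D) = (i \in D).
  by rewrite mem_imset //; apply: enum_val_inj.
have in_D i : enum_val i \in enum_val @: D <-> Q (x i) /\ Q (y i).
  by rewrite memD inE; split=> /asboolP.
split=> //; split.
  by apply/subsetP => _ /imsetP[i _ ->]; apply: enum_valP.
set S := enum_val @: D in memD in_D *.
(* From here on, the computations take place in the residue field of Q. *)
pose pi := residue_map primeQ.
have pi0 f : pi f = 0 <-> Q f by exact: residue_map_eq0.
have live i : enum_val i \notin S -> pi (x i) != 0 \/ pi (y i) != 0.
  move=> iS; have [x0|] := eqVneq (pi (x i)) 0; last by left.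
  have [y0|] := eqVneq (pi (y i)) 0; last by right.
  by case/negP: iS; apply/in_D; split; apply/pi0.
have adj_prop (i j : 'I_n) : adj G (enum_val i) (enum_val j) ->
    pi (x i) * pi (y j) = pi (x j) * pi (y i).
  move=> /edge_binomial_ideal/subQ/pi0; rewrite rmorphB !rmorphM => /eqP.
  by rewrite subr_eq0 => /eqP.
have conn_prop (i j : 'I_n) : connect (del_adj G S) (enum_val i) (enum_val j) ->
    pi (x i) * pi (y j) = pi (x j) * pi (y i).
  case/connectP => p; elim: p i => [|u p IH] i /=.
    by move=> _ /enum_val_inj->.
  case/andP=> /and3P[iu iS uS] up lastp.
  have uV : u \in vset G by have /andP[] := adj_vset iu.
  have ku : enum_val (enum_rank_in uV u) = u by rewrite enum_rankK_in.
  move: (enum_rank_in uV u) ku => k ku; rewrite -ku in iu up lastp uS.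
  exact: proportional_trans (live k uS) (adj_prop _ _ iu) (IH k up lastp).
move=> f Pf; apply/pi0; apply: (block_prime_factor _ _ _ _ Pf) => i.
- exact: comp_rep_idem.
- by rewrite inE => /in_D[]; split; apply/pi0.
- by rewrite -(comp_rep_deleted S) inE => /live.
- move=> _; apply: conn_prop; rewrite enum_val_comp_rep; exact: connect_root.
Qed.

End GraphPrimes.

(** * Minimal primes and unmixedness *)

Lemma has_height_inj (A : comNzRingType) (P : A -> Prop) h1 h2 :
  has_height P h1 -> has_height P h2 -> h1 = h2.
Proof.
case=> [[Q1 ch1] max1] [[Q2 ch2] max2].
by apply/eqP; rewrite eqn_leq (max1 _ _ ch2) (max2 _ _ ch1).
Qed.

Section Release.
Variables (K : fieldType) (n : nat) (dead : {set 'I_n}) (r : 'I_n -> 'I_n).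
Variables (i i0 : 'I_n).
Hypothesis iD : i \in dead.
Hypothesis r_live : forall j, j \notin dead -> r j \notin dead.

(** Letting the vertex i live again, in the block represented by i0, or in a
block of its own when i0 = i, yields a smaller prime: killing x i and y i
afterwards leads back to block_map, since i represents no other block. *)
Lemma block_prime_release :
  subideal (block_prime (K := K) (dead :\ i)
    (fun j => if j == i then i0 else r j))
           (block_prime dead r).
Proof.
set r' := fun j : 'I_n => _.
pose sigma : {rmorphism {mpoly K[n + n]} -> {mpoly K[n + n]}} :=
  mmap (@mpolyC (n + n) K)
    (split_case (fun j => if j == i then 0 else 'X_(lshift n j))
                (fun j => if j == i then 0 else 'X_(rshift n j))).
have sigma_x j : sigma 'X_(lshift n j) = if j == i then 0 else 'X_(lshift n j).
  by rewrite /= mmapX mmap1U split_caseL.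
have sigma_y j : sigma 'X_(rshift n j) = if j == i then 0 else 'X_(rshift n j).
  by rewrite /= mmapX mmap1U split_caseR.
have live_i j : j \notin dead -> (j == i) = false.
  by move=> jL; apply/eqP => ji; rewrite ji iD in jL.
have scale_i : i0 != i -> sigma (scale_factor K r' i) = 0.
  by move=> ii0; rewrite /scale_factor /r' eqxx (negPf ii0) sigma_x eqxx.
have scale_j j : j \notin dead -> sigma (scale_factor K r' j) = scale_factor K
  r j.
  move=> jL; rewrite /scale_factor /r' (live_i j jL).
  by case: ifP => _; [rewrite rmorph1 | rewrite sigma_x live_i].
suff fact : block_map K dead r =1 sigma \o block_map K (dead :\ i) r'.
  by move=> f f0; exact: etrans (fact f)
    (etrans (congr1 sigma f0) (rmorph0 sigma)).
apply: mpoly_morph_eq => [c|z]; first by rewrite /= block_mapC /= !mmapC.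
case: (split_ordP z) => j ->; rewrite [RHS]/=.
  rewrite [LHS]block_map_x [X in sigma X]block_map_x in_setD1;
    have [-> /=|ji /=] := eqVneq j i.
    rewrite iD rmorphM sigma_x {1}/r' eqxx; case: eqP => [_|/eqP ii0];
      first by rewrite mul0r.
    by rewrite scale_i ?mulr0.
  case: ifPn => [_|jL]; first by rewrite rmorph0.
  by rewrite rmorphM scale_j // sigma_x {1 2}/r' (negPf ji) live_i ?r_live.
rewrite [LHS]block_map_y [X in sigma X]block_map_y in_setD1;
  have [-> /=|ji /=] := eqVneq j i.
  rewrite iD rmorphM sigma_y {1}/r' eqxx; case: eqP => [_|/eqP ii0];
    first by rewrite mul0r.
  by rewrite scale_i ?mulr0.
case: ifPn => [_|jL]; first by rewrite rmorph0.
by rewrite rmorphM scale_j // sigma_y {1 2}/r' (negPf ji) live_i ?r_live.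
Qed.

End Release.

Section Unmixed.
Variables (K : fieldType) (T : finType) (G : sgraph T).
Local Notation n := #|vset G|.
Local Notation R := {mpoly K[n + n]}.
Local Notation x i := ('X_(lshift n i) : R).
Local Notation y i := ('X_(rshift n i) : R).
Local Notation J := (@binomial_edge_ideal K T G).
Local Notation comp_prime := (@comp_prime K T G).
Local Notation deleted := (@deleted T G).
Local Notation comp_rep := (@comp_rep T G).
Implicit Types (S : {set T}).

(** The n vertices are those of S, one representative for each component, and
the others; the last ones and twice the first ones make up the height. *)
Lemma comp_prime_height S : S \subset vset G ->
  exists2 h, has_height (comp_prime S) h & (h + num_comp G S = #|S| + n)%N.
Proof.
move=> SG; eexists;
  first exact: (block_prime_height K (@comp_rep_idem T G S)
  (@comp_rep_deleted T G S)).
have mem_S t : t \in S -> exists i : 'I_n, enum_val i = t.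
  move/(subsetP SG) => tG; exists (enum_rank_in tG t); exact: enum_rankK_in.
have -> : #|S| = #|deleted S|.
  rewrite -(card_imset _ enum_val_inj); apply: eq_card => t.
  apply/idP/imsetP => [tS|[i]]; last by rewrite inE => iS ->.
  by have [i it] := mem_S t tS; exists i; rewrite ?inE it.
have -> : num_comp G S = #|[set i : 'I_n | (i \notin deleted S) &&
  (comp_rep S i == i)]|.
  rewrite -(card_imset _ enum_val_inj); apply: eq_card => t; rewrite inE /=.
  apply/andP/imsetP => [[/eqP rt]|[i]].
    rewrite !inE => /andP[tS tG].
    exists (enum_rank_in tG t); last by rewrite enum_rankK_in.
    rewrite !inE enum_rankK_in // tS -(inj_eq enum_val_inj) enum_val_comp_rep.
    by rewrite enum_rankK_in // rt eqxx.
  rewrite !inE => /andP[iS /eqP ri] ->; rewrite iS enum_valP; split=> //.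
  by apply/eqP; rewrite -enum_val_comp_rep ri.
rewrite mul2n -addnn -!addnA; congr addn.
rewrite -[X in _ = X]card_ord -(cardC (mem (deleted S))); congr addn.
rewrite -(cardID [pred i | comp_rep S i == i] [predC deleted S]) addnC.
by congr addn; apply: eq_card => i; rewrite !inE // /nonrep inE andbC.
Qed.

(** A prime Q between J and P_S contains P_S' for some S' inside S. If t were in
S but not in S', its neighbours u and w in different components of G \ S would
be joined through t in G \ S', and their binomial would lie in P_S' but not in
P_S. *)
Lemma cut_set_minimal_prime S :
  cut_set G S -> is_minimal_prime J (comp_prime S).
Proof.
move=> cutS; split; first exact: block_prime_is_prime.
  exact: comp_prime_contains.
move=> Q primeQ JQ QS;
  have [S' [S'_xy [S'G S'Q]]] := prime_contains_comp_prime primeQ JQ.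
suff <- : S' = S by [].
have sS'S : S' \subset S.
  apply/subsetP => t tS'; have tG := subsetP S'G t tS'.
  have := tS'; rewrite -(enum_rankK_in tG tG) => /S'_xy[/QS + _].
  by move=> /block_prime_x; rewrite inE.
apply/eqP; rewrite eqEsubset sS'S; apply/subsetP => t tS; apply: contraT => tS'.
have [u [w [tu tw uS wS /negP[]]]] := cut_setP _ _ cutS t tS.
have uS' : u \notin S' by apply: contra uS; apply: subsetP.
have wS' : w \notin S' by apply: contra wS; apply: subsetP.
have uw : connect (del_adj G S') u w.
  apply: (@connect_trans _ _ t); apply: connect1; rewrite /del_adj.
    by rewrite adj_sym tu uS' tS'.
  by rewrite tw tS' wS'.
have uG : u \in vset G by have /andP[] := adj_vset tu.
have wG : w \in vset G by have /andP[] := adj_vset tw.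
rewrite -(enum_rankK_in uG uG) -(enum_rankK_in wG wG) -comp_rep_eq; apply/eqP.
have live S0 (z : T) (zG : z \in vset G) : z \notin S0 ->
    enum_rank_in zG z \notin deleted S0 by rewrite inE enum_rankK_in.
apply/(block_prime_binomial K _ (live _ _ uG uS) (live _ _ wG wS)).
apply: QS; apply: S'Q.
apply/(block_prime_binomial K _ (live _ _ uG uS') (live _ _ wG wS')).
by apply/eqP; rewrite comp_rep_eq !enum_rankK_in.
Qed.

(** A minimal prime is some P_S. If t in S had all its neighbours outside S in
one component, t could be released into that component, and the resulting
smaller prime would still contain J. *)
Lemma minimal_prime_cut_set (P : R -> Prop) :
  is_minimal_prime J P -> exists2 S, cut_set G S & P = comp_prime S.
Proof.
case=> primeP JP minP;
  have [S [_ [SG SP]]] := prime_contains_comp_prime primeP JP.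
have PS := minP _ (block_prime_is_prime K _ _) (@comp_prime_contains K T G S)
  SP.
exists S; last by apply/funext => f; apply/propext; split;
  [apply: PS | apply: SP].
apply: contraT => /forall_inPn[t tS nocut].
have tG := subsetP SG t tS; have ti := enum_rankK_in tG tG.
set i := enum_rank_in tG t in ti.
have iD : i \in deleted S by rewrite inE ti.
have connN (u w : 'I_n) : adj G t (enum_val u) -> adj G t (enum_val w) ->
    u \notin deleted S -> w \notin deleted S -> comp_rep S u = comp_rep S w.
  rewrite !inE => tu tw uS wS; apply/eqP; rewrite comp_rep_eq.
  apply: contraNT nocut => uw; apply/existsP; exists (enum_val u).
  by apply/existsP; exists (enum_val w); rewrite tu tw uS wS.
(* The block that t joins; t gets a block of its own if all its neighbours are
in S. *)
pose i0 :=
  if [pick u : 'I_n | adj G t (enum_val u) && (u \notin deleted S)] is Some u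
  then comp_rep S u else i.
have i0P u : adj G t (enum_val u) -> u \notin deleted S -> comp_rep S u = i0.
  rewrite /i0 => tu uS; case: pickP => [w /andP[tw wS]|/(_ u)];
    first exact: connN.
  by rewrite tu uS.
have r_live j : j \notin deleted S -> comp_rep S j \notin deleted S.
  by rewrite comp_rep_deleted.
have rel := block_prime_release (K := K) (i0 := i0) iD r_live.
set r' := fun j : 'I_n => _ in rel.
have JQ : subideal J (block_prime (K := K) (deleted S :\ i) r').
  apply: block_prime_contains => j k; rewrite !in_setD1 !negb_and !negbK /r'.
  have [->|ji] := eqVneq j i; have [->|ki] := eqVneq k i => //= jL kL jk.
  - by rewrite -(i0P k) // -ti.
  - by rewrite (i0P j) // adj_sym -ti.
  - apply/eqP; rewrite comp_rep_eq; apply: connect1; rewrite /del_adj jk.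
    by move: jL kL; rewrite !inE => -> ->.
have := minP _ (block_prime_is_prime K _ _) JQ (fun f Qf => SP f (rel f Qf))
  ('X_(lshift n i)).
have Sx : comp_prime S (x i) by apply/block_prime_x.
by move=> /(_ (SP _ Sx))/block_prime_x; rewrite !inE eqxx.
Qed.

Theorem unmixed_cut_sets :
  unmixed J <->
  forall S, cut_set G S -> num_comp G S = (#|S| + num_comp G set0)%N.
Proof.
have cut0 : cut_set G set0 by apply/cut_setP => i; rewrite inE.
have [h0 hh0] := comp_prime_height (sub0set (vset G));
  rewrite cards0 add0n => e0.
split=> [unm S cutS|card_cut P1 P2].
  have [h hh e] := comp_prime_height (cut_set_vset cutS).
  have := unm _ _ (cut_set_minimal_prime cutS) (cut_set_minimal_prime cut0) h.
  move=> [/(_ hh)/(has_height_inj hh0) eh _]; lia.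
move=> /minimal_prime_cut_set[S1 c1 ->] /minimal_prime_cut_set[S2 c2 ->] h.
have [h1 hh1 e1] := comp_prime_height (cut_set_vset c1).
have [h2 hh2 e2] := comp_prime_height (cut_set_vset c2).
have eh : h1 = h2 by move: (card_cut _ c1) (card_cut _ c2); lia.
split=> hh; first by rewrite -(has_height_inj hh1 hh) eh.
by rewrite -(has_height_inj hh2 hh) -eh.
Qed.

End Unmixed.

(** * Minimal separators *)

(** Otherwise the component of a in G \ A would not grow when i is put back, and
would not reach b. *)
Lemma separator_neighbour (T : finType) (G : sgraph T) (A : {set T}) i a b :
    a \notin A -> ~~ connect (del_adj G A) a b ->
    connect (del_adj G (A :\ i)) a b ->
  exists u, [/\ adj G i u, u \notin A & connect (del_adj G A) a u].
Proof.
move=> aA nab ab; apply: contrapT => none; case/negP: nab.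
have comp_notin u : connect (del_adj G A) a u -> u \notin A.
  by move=> au; rewrite -(connect_del_deleted au).
pose C := [set u | connect (del_adj G A) a u].
have clC : closed (del_adj G (A :\ i)) C.
  apply: intro_closed; first exact: connect_del_sym.
  move=> u w /and3P[uw _ wA]; rewrite !inE => au; have uA := comp_notin u au.
  apply: (connect_trans au); apply: connect1; rewrite /del_adj uw uA /=.
  move: wA; rewrite !inE negb_and negbK => /orP[/eqP wi|//].
  by case: none; exists u; split=> //; rewrite -wi adj_sym.
by have := closed_connect clC ab; rewrite !inE connect0.
Qed.

(** Each vertex of a minimal separator has a neighbour in the component of a and
one in the component of b. *)
Lemma minimal_separator (T : finType) (G : sgraph T) a b :
    a != b -> ~~ adj G a b ->
  exists A,
    [/\ cut_set G A, a \notin A, b \notin A & ~~ connect (del_adj G A) a b].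
Proof.
move=> ab nadj.
pose sep (A : {set T}) :=
  [&& a \notin A, b \notin A & ~~ connect (del_adj G A) a b].
have: exists A, sep A.
  exists (~: [set a; b]); rewrite /sep !inE !eqxx orbT /=.
  apply/connectP => -[[|u p] /=]; first by move=> _ /esym/eqP;
    rewrite (negPf ab).
  case/andP => /and3P[au _]; rewrite !inE negbK => /orP[]/eqP uab.
    by rewrite uab adj_irrefl in au.
  by rewrite uab (negPf nadj) in au.
case/ex_minset => A /minsetP[/and3P[aA bA nab] minA].
exists A; split=> //; apply/cut_setP => i iA.
have notin z : z \notin A -> z \notin A :\ i
  by rewrite !inE negb_and orbC => ->.
have conn : connect (del_adj G (A :\ i)) a b.
  apply: contraT => nab'; have := minA (A :\ i).
  rewrite /sep !notin // subD1set => /(_ nab' isT) eA.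
  by rewrite -eA !inE eqxx in iA.
have [u [iu uA au]] := separator_neighbour aA nab conn.
have nba : ~~ connect (del_adj G A) b a by rewrite connect_del_sym.
have [|w [iw wA bw]] := separator_neighbour bA nba (i := i).
  by rewrite connect_del_sym.
exists u, w; split=> //; apply: contra nab => uw.
by apply: connect_trans au (connect_trans uw _); rewrite connect_del_sym.
Qed.

(** * Deletions in a disjoint union *)

Section GluedDeletions.
Variables (T : finType) (G : sgraph T).
Implicit Types (A B H S : {set T}).

(** A walk that starts in H stays in H, so that it can only meet S inside H. *)
Lemma connect_del_local H S S' u w :
    closed (adj G) H -> u \in H -> S :&: H = S' :&: H ->
  connect (del_adj G S) u w = connect (del_adj G S') u w.
Proof.
move=> clH; wlog suff sub : S S' / S :&: H = S' :&: H -> u \in H ->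
    connect (del_adj G S) u w -> connect (del_adj G S') u w.
  by move=> uH eS; apply/idP/idP; apply: sub.
move=> eS uH /connectP[p]; elim: p u uH => [|z p IH] u uH /=.
  by move=> _ ->; exact: connect0.
case/andP => /and3P[uz uS zS] zp lastp.
have zH : z \in H by rewrite -(clH _ _ uz).
apply: connect_trans (IH z zH zp lastp); apply: connect1.
have memS t : t \in H -> (t \in S) = (t \in S').
  by move=> tH; have := congr1 (fun X : {set T} => t \in X) eS;
    rewrite !inE tH !andbT.
by rewrite /del_adj uz -!memS // uS zS.
Qed.

Definition glue H A B := (A :&: H) :|: (B :\: H).

Lemma glue_in H A B : glue H A B :&: H = A :&: H.
Proof. by apply/setP => t; rewrite !inE; case: (t \in H);
  rewrite ?andbT ?andbF ?orbF. Qed.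

Lemma glue_out H A B : glue H A B :&: ~: H = B :&: ~: H.
Proof. by apply/setP => t; rewrite !inE; case: (t \in H);
  rewrite ?andbT ?andbF ?orbF. Qed.

Lemma glueC H A B : glue (~: H) A B = glue H B A.
Proof. by apply/setP => t;
  rewrite !inE negbK orbC [_ && (t \in B)]andbC [_ && (t \in A)]andbC. Qed.

Lemma card_glue H A B : #|glue H A B| = (#|A :&: H| + #|B :\: H|)%N.
Proof.
rewrite cardsU (_ : A :&: H :&: (B :\: H) = set0) ?cards0 ?subn0 //.
by apply/setP => t; rewrite !inE; case: (t \in H); rewrite ?andbF.
Qed.

Lemma closedC H : closed (adj G) H -> closed (adj G) (~: H).
Proof. by move=> clH u w uw; rewrite !inE (clH _ _ uw). Qed.

Lemma cut_set_glue H A B :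
  closed (adj G) H -> cut_set G A -> cut_set G B -> cut_set G (glue H A B).
Proof.
have half H' A' B' i :
    closed (adj G) H' -> cut_set G A' -> i \in A' -> i \in H' ->
  exists u w, [/\ adj G i u, adj G i w, u \notin glue H' A' B',
      w \notin glue H' A' B'
      & ~~ connect (del_adj G (glue H' A' B')) u w].
  move=> clH /cut_setP cutA iA iH; have [u [w [iu iw uA wA uw]]] := cutA i iA.
  have uH : u \in H' by rewrite -(clH _ _ iu).
  have wH : w \in H' by rewrite -(clH _ _ iw).
  exists u, w; rewrite !inE uH wH (negPf uA) (negPf wA); split=> //.
  by rewrite (connect_del_local w clH uH (glue_in _ _ _)).
move=> clH cutA cutB; apply/cut_setP => i; rewrite !inE => /orP[]/andP[].
  exact: half.
by move=> iH iB; rewrite -glueC; apply: half; rewrite ?inE //; apply: closedC.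
Qed.

Definition num_comp_in H S :=
  #|[set t in vset G :\: S | (t \in H) &&
    (fingraph.root (del_adj G S) t == t)]|.

Lemma num_comp_in_local H S S' :
  closed (adj G) H -> S :&: H = S' :&: H -> num_comp_in H S = num_comp_in H S'.
Proof.
move=> clH eS; apply: eq_card => t; rewrite !inE.
have [tH|] := boolP (t \in H); last by rewrite !andbF.
have -> : (t \in S) = (t \in S').
  by have := congr1 (fun X : {set T} => t \in X) eS; rewrite !inE tH !andbT.
congr [&& _ & _ == t]; congr odflt; apply: eq_pick => w.
exact: connect_del_local eS.
Qed.

Lemma num_comp_split H S : num_comp G S =
  (num_comp_in H S + num_comp_in (~: H) S)%N.
Proof.
rewrite /num_comp /n_comp_mem -(cardID H); congr addn; apply: eq_card => t;
  rewrite !inE.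
  by case: (t \in H); rewrite ?andbT ?andbF //= andbC.
by case: (t \in H); rewrite ?andbT ?andbF //= andbC.
Qed.

Lemma num_comp_glue H A B : closed (adj G) H ->
  num_comp G (glue H A B) = (num_comp_in H A + num_comp_in (~: H) B)%N.
Proof.
move=> clH; rewrite (num_comp_split H) (num_comp_in_local clH (glue_in H A B)).
by rewrite (num_comp_in_local (closedC clH) (glue_out H A B)).
Qed.

End GluedDeletions.

(** * Deletion of the common vertex *)

Section DeleteVertex.
Variables (T : finType) (G : sgraph T) (v : T).
Local Notation D := (del_vertices G [set v]).
Implicit Types (S : {set T}).

Lemma del_adj_del_vertices S : del_adj D S =2 del_adj G (v |: S).
Proof.
move=> x y; rewrite /del_adj /= /del_adj !inE !negb_or.
by case: (adj G x y); case: (x == v); case: (y == v); rewrite ?andbT ?andbF.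
Qed.

Lemma num_comp_del_vertices S : num_comp D S = num_comp G (v |: S).
Proof.
rewrite /num_comp (eq_n_comp (eq_connect (del_adj_del_vertices S))).
by apply: eq_n_comp_r => t; rewrite !inE negb_or andbA [(t != v) && _]andbC.
Qed.

(** The vertex v itself has its neighbours a and b in different components. *)
Lemma cut_set_add_vertex S a b :
    cut_set D S -> adj G v a -> adj G v b -> a \notin S -> b \notin S ->
    ~~ connect (del_adj D S) a b ->
  cut_set G (v |: S).
Proof.
move=> /cut_setP cutS va vb aS bS ab.
have neq_v t : adj G v t -> t != v.
  by move=> vt; apply: contraTneq vt => ->; rewrite adj_irrefl.
apply/cut_setP => i; rewrite in_setU1 => /orP[/eqP ->|/cutS].
  exists a, b; rewrite !inE !negb_or !neq_v //
    -(eq_connect (del_adj_del_vertices S)).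
  by split.
case=> u [w [/= /and3P[iu _ uv] /and3P[iw _ wv] uS wS uw]].
exists u, w; rewrite -(eq_connect (del_adj_del_vertices S)) !in_setU1 !negb_or.
by rewrite !inE in uv wv; rewrite uv wv uS wS.
Qed.

End DeleteVertex.

Lemma nonfree_neighbours (T : finType) (G : sgraph T) v :
  ~ free_vertex G v -> exists a b,
    [/\ adj G v a, adj G v b, a != b & ~~ adj G a b].
Proof.
move=> nfree; apply: contrapT => none; apply: nfree => a b va vb ab.
by apply: contraT => nab; case: none; exists a, b.
Qed.

Theorem lemma3p5 (K : fieldType) (T : finType) (G G1 G2 : sgraph T) (v : T) :
  is_union G G1 G2 ->
  connected_graph G ->
  vset G1 :&: vset G2 = [set v] ->
  unmixed (@binomial_edge_ideal K T G) ->
  ~ free_vertex G1 v ->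
  ~ free_vertex G2 v ->
  unmixed (@binomial_edge_ideal K T (del_vertices G [set v])).
Proof.
move=> [_ adjG] _ G12 /unmixed_cut_sets unmG nfree1 nfree2.
set D := del_vertices G [set v]; pose H := vset G1 :\ v.
have capv t : t \in vset G1 -> t \in vset G2 -> t = v.
  by move=> t1 t2; apply/set1P; rewrite -G12 inE t1 t2.
have clH : closed (adj D) H.
  move=> x y /and3P[]; rewrite adjG !inE => /orP[] /adj_vset/andP[xG yG] xv yv.
    by rewrite xv yv xG yG.
  rewrite xv yv /=; apply/idP/idP => [/capv|/capv] eqv.
    by rewrite eqv ?eqxx in xv.
  by rewrite eqv ?eqxx in yv.
have [a1 [b1 [va1 vb1 ab1 nab1]]] := nonfree_neighbours nfree1.
have [a2 [b2 [va2 vb2 ab2 nab2]]] := nonfree_neighbours nfree2.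
have neq_v (G' : sgraph T) t : adj G' v t -> t != v.
  by move=> vt; apply: contraTneq vt => ->; rewrite adj_irrefl.
have in1 t : adj G1 v t -> t \in H.
  by move=> vt; rewrite !inE (neq_v _ _ vt); case/andP: (adj_vset vt).
have in2 t : adj G2 v t -> t \notin H.
  move=> vt; rewrite !inE (neq_v _ _ vt) /=; case/andP: (adj_vset vt) => _ t2.
  by apply: contraNN (neq_v _ _ vt) => t1; apply/eqP/capv.
have nabD1 : ~~ adj D a1 b1.
  apply/and3P => -[]; rewrite adjG (negPf nab1) /= => /adj_vset/andP[a12 _].
  by have := in1 _ va1; rewrite !inE => /andP[/eqP av /capv/(_ a12)].
have nabD2 : ~~ adj D a2 b2.
  apply/and3P => -[];
    rewrite adjG (negPf nab2) orbF => /adj_vset/andP[a21 _] av _.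
  by have := in2 _ va2; rewrite !inE a21 andbT; rewrite inE in av; rewrite av.
(* From here on, H is any closed set that separates a1, b1 from a2, b2. *)
clearbody H.
have [A1 [cutA1 aA1 bA1 sep1]] := minimal_separator ab1 nabD1.
have [A2 [cutA2 aA2 bA2 sep2]] := minimal_separator ab2 nabD2.
have cut0 : cut_set D set0 by apply/cut_setP => i; rewrite inE.
have count_good U a b :
    cut_set D U -> adj G v a -> adj G v b -> a \notin U -> b \notin U ->
    ~~ connect (del_adj D U) a b ->
  num_comp D U = (#|U| + 1 + num_comp G set0)%N.
  move=> cutU va vb aU bU ab; rewrite num_comp_del_vertices unmG; last first.
    exact: cut_set_add_vertex cutU va vb aU bU ab.
  have vU : v \notin U.
    by apply: contraTN isT => /(subsetP (cut_set_vset cutU)); rewrite !inE eqxx.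
  by rewrite cardsU1 vU add1n addn1.
(* Two neighbours of v remain separated if the part of the cut set on their side
is that of A1 (or of A2 below). *)
have count1 S : cut_set D S ->
    num_comp D (glue H A1 S) = (#|glue H A1 S| + 1 + num_comp G set0)%N.
  move=> cutS; have aH := in1 _ va1; have bH := in1 _ vb1.
  apply: (count_good _ a1 b1).
  - exact: cut_set_glue.
  - by rewrite adjG va1.
  - by rewrite adjG vb1.
  - by rewrite !inE aH (negPf aA1).
  - by rewrite !inE bH (negPf bA1).
  - by rewrite (connect_del_local b1 clH aH (glue_in _ _ _)).
have count2 S : cut_set D S ->
    num_comp D (glue H S A2) = (#|glue H S A2| + 1 + num_comp G set0)%N.
  move=> cutS; have aH := in2 _ va2; have bH := in2 _ vb2.
  apply: (count_good _ a2 b2).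
  - exact: cut_set_glue.
  - by rewrite adjG va2 orbT.
  - by rewrite adjG vb2 orbT.
  - by rewrite !inE (negPf aH) (negPf aA2) andbF.
  - by rewrite !inE (negPf bH) (negPf bA2) andbF.
  - have aHc : a2 \in ~: H by rewrite inE.
    by rewrite (connect_del_local b2 (closedC clH) aHc (glue_out _ _ _)).
apply/unmixed_cut_sets => S cutS.
have := (count1 _ cutS, count1 _ cut0, count2 _ cutS, count2 _ cut0).
rewrite !num_comp_glue // !card_glue set0I set0D cards0 => -[[[e1 e2] e3] e4].
rewrite !(num_comp_split D H) -(cardsID H S); clear -e1 e2 e3 e4; lia.
Qed.
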